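(* Assume the following condition (A) on data generating processes: (i) for each $t^\ast\in\{0,1\}$, $Z$ is independent of $(T_{t^\ast},Y_{t^\ast},T^\ast_0,T^\ast_1)$; (ii) $T^\ast_1\ge T^\ast_0$ almost surely; (iii) $0<P(Z=1)<1$. Let $P$ be an arbitrary distribution of the observed variables $(Y,T,Z)$. Then the sharp identified set $\Theta_I(P)$ for the local average treatment effect is as follows: $\Theta_I(P)=\Theta$ if $TV_{(Y,T)}=0$; otherwise $$ \Theta_I(P)=\begin{cases} \left[\Delta E_P[Y\mid Z],\ \dfrac{\Delta E_P[Y\mid Z]}{TV_{(Y,T)}}\right] & \text{if }\Delta E_P[Y\mid Z]>0,\\ \{0\} & \text{if }\Delta E_P[Y\mid Z]=0,\\ \left[\dfrac{\Delta E_P[Y\mid Z]}{TV_{(Y,T)}},\ \Delta E_P[Y\mid Z]\right] & \text{if }\Delta E_P[Y\mid Z]<0. \end{cases} $$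
   Context: Variables. $Z\in\{0,1\}$ is a binary instrument; $T^\ast_z\in\{0,1\}$ ($z=0,1$) is the counterfactual true treatment when $Z=z$; $Y_{t^\ast}$ (real-valued) and $T_{t^\ast}\in\{0,1\}$ ($t^\ast=0,1$) are the counterfactual outcome and the counterfactual measured treatment when the true treatment equals $t^\ast$. Outcomes have distributions dominated by a known finite measure $\mu_Y$ on the real line. The (unobserved) true treatment is $T^\ast=T^\ast_Z$; the observed variables are $(Y,T,Z)$ with $Y=Y_{T^\ast}$ and $T=T_{T^\ast}$. A data generating process $P^\ast$ is a joint distribution of $(Y_0,Y_1,T_0,T_1,T^\ast_0,T^\ast_1,Z)$; $P^\ast_{(Y,T,Z)}$ denotes the distribution of $(Y,T,Z)$ it induces. $\mathcal P^\ast$ is the set of all $P^\ast$ satisfying condition (A) of the claim. The distribution $P$ of $(Y,T,Z)$ satisfies $0<P(Z=1)<1$, $E_P|Y|<\infty$, and $Y$ is dominated by $\mu_Y$. The local average treatment effect is $\theta(P^\ast)=E_{P^\ast}[Y_1-Y_0\mid T^\ast_0<T^\ast_1]$. The parameter space $\Theta$ is the set of all numbers $\int y f_1(y)\,d\mu_Y(y)-\int y f_0(y)\,d\mu_Y(y)$ where $f_0,f_1$ are probability densities with respect to $\mu_Y$ (with finite first moments). The sharp identified set is $$\Theta_I(P)=\{\theta(P^\ast)\in\Theta:\ P^\ast\in\mathcal P^\ast,\ P^\ast_{(Y,T,Z)}=P\}.$$ Convention: if $P^\ast(T^\ast_0<T^\ast_1)=0$, the conditional laws of $Y_1$ and $Y_0$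 given the null event $\{T^\ast_0<T^\ast_1\}$ may be specified arbitrarily (with $\mu_Y$-densities), so that $\theta(P^\ast)$ is then allowed to be any element of $\Theta$. Notation: $\Delta E_P[X\mid Z]=E_P[X\mid Z=1]-E_P[X\mid Z=0]$. For a random variable or vector $X$ with dominating measure $\mu_X$ and conditional densities $f_{X\mid Z=z}$, $TV_X=\frac12\int|f_{X\mid Z=1}(x)-f_{X\mid Z=0}(x)|\,d\mu_X(x)$ (for $X=(Y,T)$, $\mu_X$ is the product of $\mu_Y$ and counting measure on $\{0,1\}$). *)

(* Defs.v *)
From HB Require Import structures.
From mathcomp Require Import all_boot all_order all_algebra.
From mathcomp Require Import all_classical all_reals all_analysis.

Set Implicit Arguments.
Unset Strict Implicit.
Unset Printing Implicit Defensive.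

Import Order.TTheory GRing.Theory Num.Theory.
Import numFieldNormedType.Exports.

Local Open Scope classical_set_scope.
Local Open Scope ring_scope.

(* A separate constant is needed because the library makes [counting]
   canonically sigma-finite on [nat] only. *)
Definition counting_bool (R : realType) : set bool -> \bar R := @counting bool R.

HB.instance Definition _ (R : realType) := Measure.on (@counting_bool R).

Lemma counting_bool_fin (R : realType) : fin_num_fun (@counting_bool R).
Proof.
move=> A _; rewrite /counting_bool /counting asboolT//.
exact: finite_finset.
Qed.

HB.instance Definition _ (R : realType) :=
  Measure_isFinite.Build _ _ _ (@counting_bool R) (@counting_bool_fin R).

(* Dominating measure for (Y, T).  The constant is named because the canonical
   finite-measure structures of [\x] apply to subprobabilities only. *)
Section DominatingYT.
Variables (R : realType) (mu : {finite_measure set R -> \bar R}).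

Definition muYT : set (R * bool) -> \bar R := (mu \x @counting_bool R)%E.

HB.instance Definition _ := Measure.on muYT.

Lemma muYT_fin : fin_num_fun muYT.
Proof.
apply: lty_fin_num_fun; rewrite /muYT -setXTT [ltLHS]product_measure1E//.
by rewrite lte_mul_pinfty// ?fin_num_measure// ltey_eq fin_num_measure.
Qed.

HB.instance Definition _ := Measure_isFinite.Build _ _ _ muYT muYT_fin.

End DominatingYT.

Definition indep_rv d d1 d2 (W : measurableType d) (T1 : measurableType d1)
    (T2 : measurableType d2) (R : realType) (P : probability W R)
    (X : W -> T1) (Y : W -> T2) : Prop :=
  forall A B, measurable A -> measurable B ->
    P (X @^-1` A `&` Y @^-1` B) = (P (X @^-1` A) * P (Y @^-1` B))%E.

(* P( . | A); when P(A) = 0, [mnormalize] returns the junk value P. *)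
Definition cond_prob d (W : measurableType d) (R : realType)
    (P : probability W R) (A : set W) (mA : measurable A) : probability W R :=
  mnormalize (mrestr P mA) P.

(* Values of (Y, T, Z). *)
Notation obs R := (R * bool * bool)%type.

Section Observed.
Variable R : realType.

Definition obsY (w : obs R) : R := w.1.1.
Definition obsYT (w : obs R) : R * bool := w.1.
Definition obsZ (w : obs R) : bool := w.2.

Lemma measurable_obsY : measurable_fun setT obsY.
Proof. exact: (measurableT_comp measurable_fst measurable_fst). Qed.
HB.instance Definition _ := isMeasurableFun.Build _ _ _ _ obsY measurable_obsY.

Lemma measurable_obsYT : measurable_fun setT obsYT.
Proof. exact: measurable_fst. Qed.
HB.instance Definition _ :=
  isMeasurableFun.Build _ _ _ _ obsYT measurable_obsYT.

Lemma measurable_obsZ : measurable_fun setT obsZ.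
Proof. exact: measurable_snd. Qed.
HB.instance Definition _ := isMeasurableFun.Build _ _ _ _ obsZ measurable_obsZ.

Lemma measurable_obsZ_eq (z : bool) : measurable [set w | obsZ w = z].
Proof.
rewrite -[X in measurable X]setTI.
exact: (measurable_obsZ measurableT (Y := [set z])).
Qed.

Definition given_Z (P : probability (obs R) R) (z : bool) :
  probability (obs R) R := cond_prob P (measurable_obsZ_eq z).

Definition DeltaE (P : probability (obs R) R) (X : obs R -> R) : R :=
  fine ('E_(given_Z P true)[X])%E - fine ('E_(given_Z P false)[X])%E.

Definition cond_density d (S : measurableType d)
    (muX : {sigma_finite_measure set S -> \bar R})
    (P : probability (obs R) R) (X : {mfun obs R >-> S}) (z : bool) :
    S -> \bar R :=
  Radon_Nikodym
    (charge_of_finite_measure (distribution (given_Z P z) X)) muX.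

Definition TV d (S : measurableType d)
    (muX : {sigma_finite_measure set S -> \bar R})
    (P : probability (obs R) R) (X : {mfun obs R >-> S}) : R :=
  2^-1 * fine (\int[muX]_x
    `|cond_density muX P X true x - cond_density muX P X false x|)%E.

Definition TV_YT (mu : {finite_measure set R -> \bar R})
    (P : probability (obs R) R) : R :=
  TV (muYT mu) P obsYT.

End Observed.

(* Values of (((Y_0, Y_1), (T_0, T_1)), (Tstar_0, Tstar_1), Z); in the
   coordinate maps below an index [false] stands for 0 and [true] for 1. *)
Notation dgp R := ((R * R) * (bool * bool) * (bool * bool) * bool)%type.

Section DGP.
Variable R : realType.

Definition dgpY (t : bool) (w : dgp R) : R :=
  if t then w.1.1.1.2 else w.1.1.1.1.
Definition dgpT (t : bool) (w : dgp R) : bool :=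
  if t then w.1.1.2.2 else w.1.1.2.1.
Definition dgpTstar (z : bool) (w : dgp R) : bool :=
  if z then w.1.2.2 else w.1.2.1.
Definition dgpZ (w : dgp R) : bool := w.2.

Definition true_treatment (w : dgp R) : bool := dgpTstar (dgpZ w) w.

Definition observe (w : dgp R) : obs R :=
  (dgpY (true_treatment w) w, dgpT (true_treatment w) w, dgpZ w).

Definition compliers : set (dgp R) :=
  [set w | (dgpTstar false w < dgpTstar true w)%N].

Lemma measurable_dgpTstar (z : bool) : measurable_fun setT (dgpTstar z).
Proof.
have mp : measurable_fun setT (fun w : dgp R => w.1.2).
  exact: (measurableT_comp measurable_snd measurable_fst).
case: z.
- exact: (measurableT_comp measurable_snd mp).
- exact: (measurableT_comp measurable_fst mp).
Qed.

Lemma measurable_compliers : measurable compliers.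
Proof.
have -> : compliers =
    (dgpTstar false @^-1` [set false]) `&` (dgpTstar true @^-1` [set true]).
  by apply/seteqP; split=> -[[? [[] []]] ?] //= [].
by apply: measurableI; rewrite -[X in measurable X]setTI;
  exact: measurable_dgpTstar.
Qed.

Definition assumptionA (Ps : probability (dgp R) R) : Prop :=
  [/\ forall t : bool,
        indep_rv Ps dgpZ
          (fun w => (dgpT t w, dgpY t w, dgpTstar false w, dgpTstar true w)),
      {ae Ps, forall w, (dgpTstar false w <= dgpTstar true w)%N}
    & (0 < Ps [set w | dgpZ w = true] < 1)%E].

(* The outcomes, observed or not, are dominated by mu; no moment condition on
   Y_0, Y_1 is imposed. *)
Definition admissible (mu : {finite_measure set R -> \bar R})
    (Ps : probability (dgp R) R) : Prop :=
  (forall t : bool, pushforward Ps (dgpY t) `<< mu) /\ assumptionA Ps.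

Definition induces (Ps : probability (dgp R) R) (P : probability (obs R) R) :
    Prop :=
  forall A : set (obs R), measurable A -> pushforward Ps observe A = P A.

Definition density_fin_mean (mu : {finite_measure set R -> \bar R})
    (f : R -> R) : Prop :=
  [/\ measurable_fun setT f, forall y, 0 <= f y,
      (\int[mu]_y (f y)%:E = 1)%E
    & mu.-integrable setT (fun y => (y * f y)%:E)].

Definition Theta (mu : {finite_measure set R -> \bar R}) : set R :=
  [set theta | exists f0 f1 : R -> R,
    [/\ density_fin_mean mu f0, density_fin_mean mu f1
      & theta = \int[mu]_y (y * f1 y) - \int[mu]_y (y * f0 y)]].

(* [LATE mu Ps theta]: theta is an admissible value of
   E[Y_1 - Y_0 | Tstar_0 < Tstar_1].  If the conditioning event is null, the
   conditional laws are free and every element of Theta is allowed.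
   Equality in \bar R forces the conditional expectation to be finite. *)
Definition LATE (mu : {finite_measure set R -> \bar R})
    (Ps : probability (dgp R) R) (theta : R) : Prop :=
  if Ps compliers == 0%E then Theta mu theta
  else (theta%:E = 'E_(cond_prob Ps measurable_compliers)
                      [fun w => (dgpY true w - dgpY false w)%R])%E.

Definition identified_set (mu : {finite_measure set R -> \bar R})
    (P : probability (obs R) R) : set R :=
  [set theta | Theta mu theta /\
    exists Ps : probability (dgp R) R,
      [/\ admissible mu Ps, induces Ps P & LATE mu Ps theta]].

End DGP.

(* Main.v *)
Require Import Defs.
From HB Require Import structures.
From mathcomp Require Import all_boot all_order all_algebra.
From mathcomp Require Import all_classical all_reals all_analysis.
From mathcomp Require Import measurable_realfun.
From mathcomp Require Import ring lra.

Set Implicit Arguments.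
Unset Strict Implicit.
Unset Printing Implicit Defensive.

Import Order.TTheory GRing.Theory Num.Theory.
Import numFieldNormedType.Exports.

Local Open Scope classical_set_scope.
Local Open Scope ring_scope.

(** Only compliers change their true treatment with the instrument.  Write [K t]
    for the law of the pair (outcome, measured treatment) under the true
    treatment [t], restricted to the compliers, and [Q z] for the law of the
    observed pair given that the instrument is [z].  Independence writes [Q z]
    as a sum over the true treatments taken at [z], and by monotonicity the
    always-takers and the never-takers cancel in the difference:
      Q 1 - Q 0 = K 1 - K 0
    as signed measures ([obs_law_balance]).  Let [c] be the mass of the
    compliers.  Evaluating the identity on a Hahn set of [Q 1 - Q 0] gives
    [TV <= c] ([complier_mass_ge]); integrating the outcome gives
    [Delta E Y = c * theta] ([LATE_of_compliers], through [balanced_means]).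
    Hence [theta] is the quotient of [Delta E Y] by some [c] in [TV, 1].

    Conversely every [c] in [TV, 1] is the mass of compliers of some admissible
    process.  Removing from [Q 1] and [Q 0] a common part of mass [1 - c] is
    possible because their overlap, the minimum of the two measures, has mass
    [1 - TV]; this gives
      Q z = c * B z + (1 - c) * N
    with probabilities [B 1], [B 0] and [N] ([overlap_split]).  Never-takers
    with law [N] and compliers with laws [B 1] and [B 0], all independent of the
    instrument, induce the observed law ([exists_dgp_with_complier_mass]), and
    the necessary part computes their effect.  When [TV = 0] one takes [c = 0]:
    there are no compliers, and every element of the parameter space is allowed.

    What remains is that the quotients of [Delta E Y] by the numbers of [TV, 1]
    fill the stated interval ([quotients_by_masses]). *)

(** * Measures and mixtures *)

Lemma measurable_preim d1 d2 (T1 : measurableType d1) (T2 : measurableType d2)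
    (f : T1 -> T2) (A : set T2) :
  measurable_fun setT f -> measurable A -> measurable (f @^-1` A).
Proof. by move=> mf mA; rewrite -[X in measurable X]setTI; exact: mf. Qed.

Lemma probability_EFin d (T : measurableType d) (R : realType)
    (m : probability T R) (A : set T) :
  measurable A -> exists2 x : R, 0 <= x & m A = x%:E.
Proof.
move=> mA; exists (fine (m A)); first exact: fine_ge0.
by rewrite fineK// fin_num_measure.
Qed.

(** Also true when the mass [r] is zero, where [mnormalize] returns its default
    value: both sides then vanish.  This lets a single construction cover the
    degenerate mixtures. *)
Lemma mnormalizeE d (T : measurableType d) (R : realType)
    (m : {measure set T -> \bar R}) (P : probability T R) (r : R) (A : set T) :
  measurable A -> m setT = r%:E -> m A = (r%:E * mnormalize m P A)%E.
Proof.
move=> mA mr; rewrite /mnormalize mr eqe/= orbF.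
have [r0|r0] := eqVneq r 0; last by rewrite muleCA -EFinM divff// mule1.
rewrite r0 mul0e; apply/eqP; rewrite -measure_le0.
have -> : 0%E = m setT by rewrite mr r0.
by rewrite le_measure ?inE.
Qed.

Lemma cond_probE d (W : measurableType d) (R : realType)
    (P : probability W R) (A : set W) (mA : measurable A) (p : R) :
  P A = p%:E -> p != 0 ->
  forall B, (cond_prob P mA B = P (B `&` A) * (p^-1)%:E)%E.
Proof.
move=> PA p0 B; have PT : mrestr P mA setT = p%:E by rewrite /mrestr setTI.
rewrite -[LHS]/(mnormalize (mrestr P mA) P B) /mnormalize.
by move: PT => /= ->; rewrite eqe orbF (negbTE p0).
Qed.

Lemma exists_mixture d (T : measurableType d) (R : realType)
    (P1 P0 : probability T R) (c : R) : 0 <= c <= 1 ->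
  exists P : probability T R,
    forall A, measurable A -> (P A = c%:E * P1 A + (1 - c)%:E * P0 A)%E.
Proof.
move=> /andP[c0 c1].
have c1' : 0 <= 1 - c by rewrite subr_ge0.
pose m : {measure set T -> \bar R} :=
  measure_add (mscale (NngNum c0) P1) (mscale (NngNum c1') P0).
have mE A : m A = (c%:E * P1 A + (1 - c)%:E * P0 A)%E by exact: measure_addE.
have m1 : m setT = 1%:E.
  by rewrite mE !probability_setT !mule1 -EFinD addrC subrK.
exists (mnormalize m P0) => A mA.
by rewrite -mE (mnormalizeE P0 mA m1) mul1e.
Qed.

Lemma exists_pushforward d1 d2 (T1 : measurableType d1) (T2 : measurableType d2)
    (R : realType) (P : probability T1 R) (f : T1 -> T2) :
  measurable_fun setT f ->
  exists P' : probability T2 R, forall A, P' A = P (f @^-1` A).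
Proof.
move=> mf; pose X : {mfun T1 >-> T2} := mfun_Sub (mem_set mf).
by exists (distribution P X).
Qed.

(** The restriction of [Q1 - Q0] to a set where it is positive, as a measure. *)
Lemma exists_excess d (T : measurableType d) (R : realType)
    (Q0 Q1 : probability T R) (H : set T) :
  measurable H ->
  (forall A, measurable A -> A `<=` H -> (Q0 A <= Q1 A)%E) ->
  exists e : {measure set T -> \bar R},
    forall A, measurable A -> (e A = Q1 (A `&` H) - Q0 (A `&` H))%E.
Proof.
move=> mH le01.
pose nu := cadd (charge_of_finite_measure Q1)
  (cscale (-1) (charge_of_finite_measure Q0)).
have nuE A : nu A = (Q1 A - Q0 A)%E by rewrite /nu /cadd/= cscaleN1.
have nu_ge0 A : (0 <= crestr0 nu mH A)%E.
  rewrite /crestr0; case: ifPn => // /[!inE] mA; rewrite /crestr nuE.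
  have mAH := measurableI _ _ mA mH.
  by rewrite sube_ge0 ?fin_num_measure//; apply: le01.
exists (measure_of_charge _ nu_ge0) => A mA.
transitivity (crestr0 nu mH A) => //.
by rewrite /crestr0 mem_set// /crestr nuE.
Qed.

(** On [H] the smaller of the two laws is [Q false], off [H] it is [Q true], so
    their overlap is the sum of these two restrictions and has mass [1 - tv],
    [tv] being the gap on [H].  The fraction [s = (1 - c) / (1 - tv)] of the
    overlap has mass [1 - c], and [c >= tv] means [s <= 1], so that it may be
    removed from both laws. *)
Lemma overlap_split d (T : measurableType d) (R : realType)
    (Q : bool -> probability T R) (H : set T) (c : R) :
  measurable H ->
  (forall A, measurable A -> A `<=` H -> (Q false A <= Q true A)%E) ->
  (forall A, measurable A -> A `<=` ~` H -> (Q true A <= Q false A)%E) ->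
  fine (Q true H) - fine (Q false H) <= c <= 1 ->
  exists (B : bool -> probability T R) (N : probability T R),
    forall z A, measurable A ->
      (Q z A = c%:E * B z A + (1 - c)%:E * N A)%E.
Proof.
move=> mH posH negH /andP[tc c1].
have mCH : measurable (~` H) by exact: measurableC.
have [[q1 q1_ge0 q1E] [q0 q0_ge0 q0E]] :=
  (probability_EFin (Q true) mH, probability_EFin (Q false) mH).
set tv := fine _ - fine _ in tc.
have tvE : tv = q1 - q0 by rewrite /tv q1E q0E.
have tv_ge0 : 0 <= tv.
  by rewrite tvE subr_ge0 -lee_fin -q1E -q0E; exact: posH.
(* For [tv = 1] the quotient is [0 / 0 = 0], the right value as [c] is then 1. *)
pose s := (1 - c) / (1 - tv).
have sE : s * (1 - tv) = 1 - c.
  rewrite /s; have [tv1|tv1] := eqVneq (1 - tv) 0; last by rewrite divfK.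
  rewrite tv1 mulr0; apply/eqP; rewrite eq_sym subr_eq0 eq_le c1 andbT.
  by rewrite (le_trans _ tc)// -subr_le0 tv1.
have s_ge0 : 0 <= s by rewrite divr_ge0// subr_ge0// (le_trans tc).
have s_le1 : 0 <= 1 - s.
  rewrite subr_ge0 /s; have [->|tv1] := eqVneq (1 - tv) 0.
    by rewrite invr0 mulr0.
  rewrite ler_pdivrMr ?mul1r ?lerD2l ?lerN2//.
  by rewrite lt_neqAle eq_sym tv1 subr_ge0 (le_trans tc).
have [e1 e1E] := exists_excess mH posH.
have [e0 e0E] := exists_excess mCH negH.
pose e z : {measure set T -> \bar R} := if z then e1 else e0.
(* What is left of [Q z]: a fraction of [Q z] itself and a fraction of its
   excess over the other law. *)
pose a z : {measure set T -> \bar R} :=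
  measure_add (mscale (NngNum s_le1) (Q z)) (mscale (NngNum s_ge0) (e z)).
pose l : {measure set T -> \bar R} := mscale (NngNum s_ge0)
  (measure_add (mrestr (Q false) mH) (mrestr (Q true) mCH)).
have aE z A : a z A = ((1 - s)%:E * Q z A + s%:E * e z A)%E by exact: measure_addE.
have lE A : l A =
    (s%:E * (Q false (A `&` H) + Q true (A `&` ~` H)))%E.
  by rewrite -(measure_addE (mrestr (Q false) mH) (mrestr (Q true) mCH)).
have QE z A : measurable A -> (Q z A = a z A + l A)%E.
  move=> mA.
  have mAH := measurableI _ _ mA mH; have mACH := measurableI _ _ mA mCH.
  have [u0 _ u0E] := probability_EFin (Q false) mAH.
  have [u1 _ u1E] := probability_EFin (Q true) mAH.
  have [v0 _ v0E] := probability_EFin (Q false) mACH.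
  have [v1 _ v1E] := probability_EFin (Q true) mACH.
  have QA z' : Q z' A = (Q z' (A `&` H) + Q z' (A `&` ~` H))%E.
    by rewrite addeC -setDE -measureDI.
  rewrite aE lE !QA.
  by case: z; rewrite /e ?e1E ?e0E// !(u0E, u1E, v0E, v1E) -!(EFinN, EFinD, EFinM);
    congr EFin; ring.
have aT z : a z setT = c%:E.
  have Q1CH : Q true (~` H) = (1 - q1)%:E by rewrite probability_setC// q1E.
  have Q0CH : Q false (~` H) = (1 - q0)%:E by rewrite probability_setC// q0E.
  rewrite aE probability_setT mule1.
  by case: z; rewrite /e ?e1E ?e0E// !setTI !(q1E, q0E, Q1CH, Q0CH)
    -!(EFinN, EFinD, EFinM); congr EFin; rewrite -[RHS](subKr 1) -sE tvE; ring.
have lT : l setT = (1 - c)%:E.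
  have := QE true setT measurableT; rewrite aT probability_setT.
  case: (l setT) => [x|//|//]; rewrite -EFinD => -[->].
  by congr EFin; ring.
exists (fun z => mnormalize (a z) (Q z)), (mnormalize l (Q true)) => z A mA.
by rewrite -!mnormalizeE// QE.
Qed.

(** * Densities *)

(** The set where the second density is the larger one is a Hahn set of
    [Q1 - Q0]; the L1 distance of the densities is the gap on this set plus the
    opposite gap on its complement, and the two are equal because both laws have
    mass one. *)
Lemma Radon_Nikodym_Hahn d (T : measurableType d) (R : realType)
    (m : {sigma_finite_measure set T -> \bar R}) (Q0 Q1 : probability T R) :
  Q0 `<< m -> Q1 `<< m ->
  let g0 := Radon_Nikodym (charge_of_finite_measure Q0) m in
  let g1 := Radon_Nikodym (charge_of_finite_measure Q1) m in
  exists H : set T,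
    [/\ measurable H,
      forall A, measurable A -> A `<=` H -> (Q0 A <= Q1 A)%E,
      forall A, measurable A -> A `<=` ~` H -> (Q1 A <= Q0 A)%E &
      2^-1 * fine (\int[m]_x `|g1 x - g0 x|)%E = fine (Q1 H) - fine (Q0 H)].
Proof.
move=> Q0m Q1m g0 g1.
have ig0 : m.-integrable setT g0 by exact: Radon_Nikodym_integrable.
have ig1 : m.-integrable setT g1 by exact: Radon_Nikodym_integrable.
have mg0 := measurable_int _ ig0; have mg1 := measurable_int _ ig1.
have Q0E A : measurable A -> (Q0 A = \int[m]_(x in A) g0 x)%E.
  by move=> mA; rewrite -Radon_Nikodym_integral.
have Q1E A : measurable A -> (Q1 A = \int[m]_(x in A) g1 x)%E.
  by move=> mA; rewrite -Radon_Nikodym_integral.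
pose H := [set x | (g0 x <= g1 x)%E].
have mH : measurable H.
  rewrite -[H]setTI; exact: measurable_lee.
have mCH : measurable (~` H) by exact: measurableC.
have igA A g : measurable A -> m.-integrable setT g -> m.-integrable A g.
  by move=> mA ig; exact: integrableS ig.
exists H; split=> //.
- move=> A mA AH; rewrite Q0E// Q1E//; apply: le_integral => //; try exact: igA.
  by move=> x /[!inE] /AH.
- move=> A mA AH; rewrite Q0E// Q1E//; apply: le_integral => //; try exact: igA.
  by move=> x /[!inE] /AH /negP; rewrite -ltNge => /ltW.
have Hint : (\int[m]_(x in H) `|g1 x - g0 x| = Q1 H - Q0 H)%E.
  rewrite Q0E// Q1E// -integralB//; try exact: igA.
  by apply: eq_integral => x /[!inE] Hx; rewrite gee0_abs// sube_ge0//
    Radon_Nikodym_fin_num.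
have CHint : (\int[m]_(x in ~` H) `|g1 x - g0 x| = Q0 (~` H) - Q1 (~` H))%E.
  rewrite Q0E// Q1E// -integralB//; try exact: igA.
  apply: eq_integral => x /[!inE] /negP; rewrite -ltNge => Hx.
  by rewrite -(abseN (g1 x - g0 x)) fin_num_oppeB ?Radon_Nikodym_fin_num//
    addeC gee0_abs// sube_ge0 ?Radon_Nikodym_fin_num// ltW.
have -> : (\int[m]_x `|g1 x - g0 x| = Q1 H - Q0 H + (Q0 (~` H) - Q1 (~` H)))%E.
  rewrite -Hint -CHint -(setvU H) setUC integral_setU//; last exact/disj_setPCl.
  rewrite setUv.
  by apply: (measurableT_comp (f := abse)) => //; exact: emeasurable_funB.
have [[q1 _ q1E] [q0 _ q0E]] := (probability_EFin Q1 mH, probability_EFin Q0 mH).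
rewrite !probability_setC// q1E q0E -!(EFinN, EFinD)/=.
by field.
Qed.

(** Witnesses membership in the parameter space: the density is the nonnegative
    version of the Radon-Nikodym derivative, which serves the absolute first
    moment, while the signed change of variables is available for the other
    version, equal to it almost everywhere. *)
Lemma density_of_dominated (R : realType)
    (mu : {finite_measure set R -> \bar R}) (K : probability R R) :
  K `<< mu -> K.-integrable setT EFin ->
  exists f : R -> R,
    density_fin_mean mu f /\ \int[mu]_y (y * f y) = fine (\int[K]_y y%:E).
Proof.
move=> Kmu iK.
pose g := Radon_Nikodym_SigmaFinite.f K mu.
have g_ge0 := Radon_Nikodym_SigmaFinite.f_ge0 Kmu.
have g_fin := Radon_Nikodym_SigmaFinite.f_fin_num Kmu.
have ig := Radon_Nikodym_SigmaFinite.f_integrable Kmu.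
have mg := measurable_int _ ig.
have gE y : (fine (g y))%:E = g y by rewrite fineK ?g_fin.
pose yg : R -> \bar R := (EFin \* g)%E.
have ygE : EFin \o (fun y : R => y * fine (g y)) = yg.
  by apply/funext => y; rewrite /yg/= EFinM gE.
have myg := emeasurable_funM (measurable_int _ iK) mg.
exists (fine \o g); split; first split.
- exact: measurableT_comp mg.
- by move=> y; rewrite fine_ge0// g_ge0.
- transitivity (\int[mu]_y g y)%E; first by apply: eq_integral => y _; exact: gE.
  rewrite -Radon_Nikodym_SigmaFinite.f_integral//; exact: (probability_setT K).
- apply: eq_integrable (fun y _ => esym (congr1 (@^~ y) ygE)) _ => //.
  apply: (le_integrable measurableT myg _
    (Radon_Nikodym_SigmaFinite.integrableM Kmu (fun=> abse_ge0 _) measurableT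
      (integrable_abse iK))).
  by move=> y _; rewrite /yg/= !abseM/= normr_id.
rewrite /Rintegral; congr fine; transitivity (\int[mu]_y yg y)%E.
  by rewrite -ygE.
rewrite -(Radon_Nikodym_change_of_variables Kmu measurableT iK).
apply: ae_eq_integral => //.
  by apply: emeasurable_funM; [exact: measurable_int iK|
    exact: measurable_int (Radon_Nikodym_integrable _)].
exact/ae_eqe_mul2l/ae_eq_Radon_Nikodym_SigmaFinite.
Qed.

(** * Integrals against dominated and balanced measures *)

Lemma integrable_of_le_measure d (T : measurableType d) (R : realType)
    (m' m : {measure set T -> \bar R}) (c : R) (f : T -> \bar R) :
  0 < c -> (forall A, measurable A -> (c%:E * m' A <= m A)%E) ->
  m.-integrable setT f -> m'.-integrable setT f.
Proof.
move=> c_gt0 m'm /integrableP[mf f_fin]; apply/integrableP; split=> //.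
pose cm' : {measure set T -> \bar R} := mscale (NngNum (ltW c_gt0)) m'.
have mabs : measurable_fun setT (abse \o f).
  exact: (measurableT_comp (f := abse)).
have abs0 x : (0 <= (abse \o f) x)%E by exact: abse_ge0.
have := ge0_le_measure_integral (m1 := cm') m'm measurableT abs0 mabs.
rewrite ge0_integral_mscale// => /le_lt_trans /(_ f_fin).
by rewrite muleC -lte_pdivlMr// => /lt_le_trans -> //; exact: leey.
Qed.

Lemma integrable_distribution d1 d2 (T1 : measurableType d1)
    (T2 : measurableType d2) (R : realType) (P : probability T1 R)
    (X : {mfun T1 >-> T2}) (f : T2 -> \bar R) : measurable_fun setT f ->
  (distribution P X).-integrable setT f <-> P.-integrable setT (f \o X).
Proof.
move=> mf; split=> [/integrableP[_ fin]|iX]; last exact: integrable_pushforward.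
apply/integrableP; split; first exact: measurableT_comp.
apply: le_lt_trans fin; rewrite ge0_integral_distribution//.
exact: (measurableT_comp (f := abse)).
Qed.

(** Integration of the balance of measures [q true - q false =
    c (k true - k false)].  Nonnegative integrands can be integrated against sums
    and multiples of measures without conditions, so the positive and the
    negative part of [X] are treated apart. *)
Lemma balanced_means d (T : measurableType d) (R : realType)
    (q k : bool -> probability T R) (c : R) (X : T -> R) :
  measurable_fun setT X -> 0 < c ->
  (forall A, measurable A ->
    (q true A + c%:E * k false A = q false A + c%:E * k true A)%E) ->
  (forall t A, measurable A -> (c%:E * k t A <= q t A)%E) ->
  (forall t, (q t).-integrable setT (EFin \o X)) ->
  (forall t, (k t).-integrable setT (EFin \o X)) /\
  fine (\int[q true]_x (X x)%:E) - fine (\int[q false]_x (X x)%:E) =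
  c * (fine (\int[k true]_x (X x)%:E) - fine (\int[k false]_x (X x)%:E)).
Proof.
move=> mX c_gt0 qk k_le iq.
have c_ge0 := ltW c_gt0.
have mX' : measurable_fun setT (EFin \o X) by exact/measurable_EFinP.
pose ck t : {measure set T -> \bar R} := mscale (NngNum c_ge0) (k t).
have ckE t (f : T -> \bar R) : measurable_fun setT f -> (forall x, 0 <= f x)%E ->
    (\int[ck t]_x f x = c%:E * \int[k t]_x f x)%E.
  by move=> mf f0; rewrite ge0_integral_mscale.
have ik t : (k t).-integrable setT (EFin \o X).
  exact: integrable_of_le_measure c_gt0 (k_le t) (iq t).
split=> //.
have bal (f : T -> \bar R) : measurable_fun setT f -> (forall x, 0 <= f x)%E ->
    (\int[q true]_x f x + c%:E * \int[k false]_x f x =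
     \int[q false]_x f x + c%:E * \int[k true]_x f x)%E.
  move=> mf f0; rewrite -!ckE//.
  rewrite -(@ge0_integral_measure_add _ _ _ (q true))//.
  rewrite -(@ge0_integral_measure_add _ _ _ (q false))//.
  by apply: eq_measure_integral => A mA _;
    rewrite -[LHS]/(measure_add (q true) (ck false) A)
      -[RHS]/(measure_add (q false) (ck true) A) !measure_addE; exact: qk.
have fin_pm (m : probability T R) : m.-integrable setT (EFin \o X) ->
    exists u v : R, [/\ (\int[m]_x (EFin \o X)^\+ x = u%:E)%E,
      (\int[m]_x (EFin \o X)^\- x = v%:E)%E & fine (\int[m]_x (X x)%:E) = u - v].
  move=> im; have fp := integrable_pos_fin_num measurableT im.
  have fn := integrable_neg_fin_num measurableT im.
  exists (fine (\int[m]_x (EFin \o X)^\+ x)), (fine (\int[m]_x (EFin \o X)^\- x)).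
  by rewrite !fineK//; split=> //; rewrite integralE fineB.
have [u1 [v1 [u1E v1E ->]]] := fin_pm _ (iq true).
have [u0 [v0 [u0E v0E ->]]] := fin_pm _ (iq false).
have [x1 [y1 [x1E y1E ->]]] := fin_pm _ (ik true).
have [x0 [y0 [x0E y0E ->]]] := fin_pm _ (ik false).
have := bal _ (measurable_funepos mX') (funepos_ge0 _).
have := bal _ (measurable_funeneg mX') (funeneg_ge0 _).
rewrite u1E v1E u0E v0E x1E y1E x0E y0E -!(EFinM, EFinD) => -[h1] [h2].
by move: h1 h2; lra.
Qed.

(** * Necessity: the balance between observed laws and compliers *)

Section Coordinates.
Context (R : realType).

Lemma measurable_dgpZ : measurable_fun setT (@dgpZ R).
Proof. exact: measurable_snd. Qed.

Lemma measurable_dgpY (t : bool) : measurable_fun setT (@dgpY R t).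
Proof.
have mp : measurable_fun setT (fun w : dgp R => w.1.1.1).
  exact: (measurableT_comp measurable_fst
    (measurableT_comp measurable_fst measurable_fst)).
by case: t; [exact: (measurableT_comp measurable_snd mp)|
  exact: (measurableT_comp measurable_fst mp)].
Qed.

Lemma measurable_dgpT (t : bool) : measurable_fun setT (@dgpT R t).
Proof.
have mp : measurable_fun setT (fun w : dgp R => w.1.1.2).
  exact: (measurableT_comp measurable_snd
    (measurableT_comp measurable_fst measurable_fst)).
by case: t; [exact: (measurableT_comp measurable_snd mp)|
  exact: (measurableT_comp measurable_fst mp)].
Qed.

Definition dgpYT (t : bool) (w : dgp R) : R * bool := (dgpY t w, dgpT t w).

Lemma measurable_dgpYT (t : bool) : measurable_fun setT (dgpYT t).
Proof. exact: measurable_fun_pair (measurable_dgpY t) (measurable_dgpT t). Qed.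

Lemma compliersE : @compliers R =
  dgpTstar false @^-1` [set false] `&` dgpTstar true @^-1` [set true].
Proof. by apply/seteqP; split=> -[[? [[] []]] ?] //= []. Qed.

End Coordinates.

Section ObservedLaw.
Context (R : realType) (P : probability (obs R) R).

Definition obs_law (z : bool) : probability (R * bool)%type R :=
  distribution (given_Z P z) (@obsYT R).

Lemma Z_masses : (0 < P [set w | obsZ w = true] < 1)%E ->
  exists p : bool -> R,
    [/\ forall z, 0 < p z, p true + p false = 1 &
      forall z, P [set w | obsZ w = z] = (p z)%:E].
Proof.
have mZ := @measurable_obsZ_eq R.
have [p1 _ p1E] := probability_EFin P (mZ true).
rewrite p1E !lte_fin => /andP[p1_gt0 p1_lt1].
exists (fun z => if z then p1 else 1 - p1); split.
- by case=> //; rewrite subr_gt0.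
- by rewrite addrC subrK.
- case=> //; rewrite (_ : [set _ | _] = ~` [set w | obsZ w = true]).
    by rewrite probability_setC// p1E.
  by apply/seteqP; split=> w /=; case: (obsZ w) => // /(_ erefl).
Qed.

(** The law given [Z = z] without its denominator. *)
Lemma obs_lawE (z : bool) (p : R) : P [set w | obsZ w = z] = p%:E -> p != 0 ->
  forall A, (p%:E * obs_law z A = P (@obsYT R @^-1` A `&` [set w | obsZ w = z]))%E.
Proof.
move=> pE p0 A; rewrite -[obs_law z A]/(given_Z P z (@obsYT R @^-1` A)).
by rewrite [given_Z P z _](cond_probE _ pE)// muleCA -EFinM divff// mule1.
Qed.

End ObservedLaw.

Section AnyDGP.
Context (R : realType) (P : probability (obs R) R) (Ps : probability (dgp R) R).
Hypotheses (P_Z : (0 < P [set w | obsZ w = true] < 1)%E)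
  (PsA : assumptionA Ps) (PsP : induces Ps P).

Definition complier_part (t : bool) (A : set (R * bool)) : \bar R :=
  Ps (dgpYT t @^-1` A `&` @compliers R).

(** Given [Z = z] the observed pair is that of the treatment taken at [z], and
    for each of the two treatments this event concerns variables that are jointly
    independent of [Z]. *)
Lemma obs_law_by_type (z : bool) (A : set (R * bool)) : measurable A ->
  (obs_law P z A = Ps (dgpYT true @^-1` A `&` dgpTstar z @^-1` [set true]) +
                   Ps (dgpYT false @^-1` A `&` dgpTstar z @^-1` [set false]))%E.
Proof.
move=> mA; have [p [p_gt0 _ pE]] := Z_masses P_Z.
have [ind _ _] := PsA.
have mZ : measurable (@dgpZ R @^-1` [set z]).
  exact: measurable_preim (@measurable_dgpZ R) _.
have ZE : Ps (@dgpZ R @^-1` [set z]) = (p z)%:E.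
  by rewrite -pE -PsP//; exact: measurable_obsZ_eq.
have mE t : measurable (dgpYT t @^-1` A `&` dgpTstar z @^-1` [set t]).
  apply: measurableI; first exact: measurable_preim (@measurable_dgpYT R t) _.
  exact: measurable_preim (@measurable_dgpTstar R z) _.
(* The hypothesis speaks of the tuple (T_t, Y_t, Tstar_0, Tstar_1), of which the
   event is the preimage under [f] and [g]. *)
have indt t : Ps (@dgpZ R @^-1` [set z] `&`
    (dgpYT t @^-1` A `&` dgpTstar z @^-1` [set t])) =
    ((p z)%:E * Ps (dgpYT t @^-1` A `&` dgpTstar z @^-1` [set t]))%E.
  rewrite -ZE.
  pose f (v : bool * R * bool * bool) := (v.1.1.2, v.1.1.1).
  pose g (v : bool * R * bool * bool) := if z then v.2 else v.1.2.
  have mf : measurable_fun setT f.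
    have m11 : measurable_fun setT (fun v : bool * R * bool * bool => v.1.1).
      exact: (measurableT_comp measurable_fst measurable_fst).
    by apply: measurable_fun_pair; [exact: (measurableT_comp measurable_snd m11)|
      exact: (measurableT_comp measurable_fst m11)].
  have mg : measurable_fun setT g.
    rewrite /g; case: (z); first exact: measurable_snd.
    exact: (measurableT_comp measurable_snd measurable_fst).
  have mB : measurable (f @^-1` A `&` g @^-1` [set t]).
    apply: measurableI; first exact: measurable_preim mf _.
    exact: measurable_preim mg _.
  have mz : measurable [set z] by [].
  have <- : (fun w => (dgpT t w, dgpY t w, dgpTstar false w, dgpTstar true w))
      @^-1` (f @^-1` A `&` g @^-1` [set t]) =
      dgpYT t @^-1` A `&` dgpTstar z @^-1` [set t].
    by apply/seteqP; rewrite /g; case: (z); split=> w [].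
  exact: ind t [set z] _ mz mB.
have [x _ xE] := probability_EFin (obs_law P z) mA.
have [x1 _ x1E] := probability_EFin Ps (mE true).
have [x0 _ x0E] := probability_EFin Ps (mE false).
have := obs_lawE (pE z) (lt0r_neq0 (p_gt0 z)) A.
rewrite -PsP; last first.
  apply: measurableI; last exact: measurable_obsZ_eq.
  exact: measurable_preim (@measurable_obsYT R) _.
rewrite /pushforward (_ : @observe R @^-1` _ =
    (@dgpZ R @^-1` [set z] `&`
      (dgpYT true @^-1` A `&` dgpTstar z @^-1` [set true])) `|`
    (@dgpZ R @^-1` [set z] `&`
      (dgpYT false @^-1` A `&` dgpTstar z @^-1` [set false]))).
  have -> U V : measurable U -> measurable V -> U `&` V = set0 ->
      Ps (U `|` V) = (Ps U + Ps V)%E by exact: measureU.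
  - rewrite !indt xE x1E x0E -!(EFinM, EFinD) => -[]; rewrite -mulrDr.
    by move/(mulfI (lt0r_neq0 (p_gt0 z))) ->.
  - exact: measurableI.
  - exact: measurableI.
  - by apply/seteqP; split=> // w /= [[_ [_ ->]] [_ []]].
apply/seteqP; split=> w; rewrite /preimage/= /observe/obsYT/obsZ/true_treatment/=.
- move=> [+ wz]; rewrite wz; case E : (dgpTstar z w) => Aw; by [left|right].
- by move=> [] [wz [Aw tw]]; rewrite wz tw.
Qed.

(** Those who take [t] when the instrument recommends it are those who take it
    anyway, plus the compliers; the remaining possibility, taking [t] only when
    the instrument recommends the opposite, is excluded by monotonicity. *)
Lemma monotone_split (t : bool) (A : set (dgp R)) : measurable A ->
  (Ps (A `&` dgpTstar t @^-1` [set t]) =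
   Ps (A `&` dgpTstar (~~ t) @^-1` [set t]) + Ps (A `&` @compliers R))%E.
Proof.
move=> mA; have [_ [N [mN N0 subN]] _] := PsA.
have mT z b : measurable (@dgpTstar R z @^-1` [set b]).
  exact: measurable_preim (@measurable_dgpTstar R z) _.
have mC := @measurable_compliers R.
pose D : set (dgp R) :=
  dgpTstar false @^-1` [set true] `&` dgpTstar true @^-1` [set false].
have mD : measurable D by exact: measurableI.
have PD : Ps D = 0%E.
  apply: (subset_measure0 _ _ _ N0) => // w [/= w0 w1].
  by apply: subN; rewrite /= w0 w1.
have PAD : Ps (A `&` D) = 0%E.
  by apply: (subset_measure0 _ _ _ PD) => //; exact: measurableI.
pose B := A `&` (dgpTstar false @^-1` [set t] `&` dgpTstar true @^-1` [set t]).
have mB : measurable B by apply: measurableI => //; exact: measurableI.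
have -> : Ps (A `&` dgpTstar t @^-1` [set t]) = (Ps B + Ps (A `&` @compliers R))%E.
  rewrite -measureU; [|exact: mB|exact: measurableI|].
    congr (Ps _); rewrite -setIUr; congr (A `&` _); rewrite compliersE.
    by case: (t); apply/seteqP; split=> -[[? [[] []]] ?] //=;
      rewrite /dgpTstar/=; intuition congruence.
  rewrite /B compliersE; apply/seteqP; split=> // w /= [[_ [+ +]] [_ []]].
  by case: (t) => /= *; congruence.
congr (_ + _)%E; rewrite -[LHS]adde0 -PAD -measureU;
  [|exact: mB|exact: measurableI|].
  congr (Ps _); rewrite -setIUr; congr (A `&` _).
  rewrite /D; case: (t); apply/seteqP; split=> -[[? [[] []]] ?] //=;
    rewrite /dgpTstar/=; intuition congruence.
rewrite /B /D; apply/seteqP; split=> // w /= [[_ [+ +]] [_ []]].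
by case: (t) => /= *; congruence.
Qed.

Lemma complier_part_le (t : bool) (A : set (R * bool)) : measurable A ->
  (complier_part t A <= obs_law P t A)%E.
Proof.
move=> mA; have mtA := measurable_preim (@measurable_dgpYT R t) mA.
rewrite obs_law_by_type//; case: t mtA => mtA;
  rewrite (monotone_split _ mtA) /complier_part.
- by rewrite -addeA addeCA lee_paddr// adde_ge0.
- by rewrite addeA lee_paddl// adde_ge0.
Qed.

(** Always-takers and never-takers contribute equally to both observed laws and
    cancel; the sum form avoids signed measures. *)
Lemma obs_law_balance (A : set (R * bool)) : measurable A ->
  (obs_law P true A + complier_part false A =
   obs_law P false A + complier_part true A)%E.
Proof.
move=> mA; rewrite !obs_law_by_type//.
have m1 := measurable_preim (@measurable_dgpYT R true) mA.
have m0 := measurable_preim (@measurable_dgpYT R false) mA.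
rewrite (monotone_split true m1) (monotone_split false m0) /complier_part/=.
by rewrite -!addeA; congr (_ + _)%E; rewrite addeC addeA.
Qed.

End AnyDGP.

(** * Necessity: the effect on the compliers *)

Section LATE.
Context (R : realType) (mu : {finite_measure set R -> \bar R})
  (P : probability (obs R) R) (Ps : probability (dgp R) R).
Hypotheses (P_Z : (0 < P [set w | obsZ w = true] < 1)%E)
  (P_Y : P.-integrable setT (fun w => (obsY w)%:E))
  (PsA : admissible mu Ps) (PsP : induces Ps P).

(** For a Hahn set [H] the left side is the total variation distance. *)
Lemma complier_mass_ge (H : set (R * bool)) : measurable H ->
  (obs_law P true H - obs_law P false H <= Ps (@compliers R))%E.
Proof.
move=> mH; have [_ PsA'] := PsA.
have mC := @measurable_compliers R.
have mtH t := measurable_preim (@measurable_dgpYT R t) mH.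
have K_le : (complier_part Ps true H <= Ps (@compliers R))%E.
  by rewrite le_measure ?inE//; exact: measurableI.
apply: le_trans K_le.
have := obs_law_balance P_Z PsA' PsP mH.
have [x1 _ x1E] := probability_EFin (obs_law P true) mH.
have [x0 _ x0E] := probability_EFin (obs_law P false) mH.
have [k1 _ k1E] := probability_EFin Ps (measurableI _ _ (mtH true) mC).
have [k0 k0_ge0 k0E] := probability_EFin Ps (measurableI _ _ (mtH false) mC).
rewrite /complier_part x1E x0E k1E k0E -!(EFinN, EFinD) lee_fin => -[].
by lra.
Qed.

(** The local average treatment effect exists because the laws of the outcomes
    of the compliers are, up to the factor [c], parts of the observed laws,
    which have a first moment; and it is determined by [c] alone. *)
Lemma LATE_of_compliers (c : R) : Ps (@compliers R) = c%:E -> c != 0 ->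
  exists2 theta, Theta mu theta & DeltaE P (@obsY R) = c * theta /\
    forall theta', LATE mu Ps theta' <-> theta' = theta.
Proof.
move=> cE c_neq0; have [Ps_dom PsA'] := PsA.
have c_gt0 : 0 < c by rewrite lt0r c_neq0 -lee_fin -cE measure_ge0.
pose C := cond_prob Ps (@measurable_compliers R).
have CE := cond_probE (@measurable_compliers R) cE c_neq0.
pose Y t : {mfun dgp R >-> R} := mfun_Sub (mem_set (@measurable_dgpY R t)).
pose k t : probability R R := distribution C (Y t).
pose q z : probability R R := distribution (given_Z P z) (@obsY R).
have ckE t A : (c%:E * k t A = complier_part Ps t (fst @^-1` A))%E.
  rewrite -[k t A]/(C (dgpY t @^-1` A)) [C _]CE muleCA -EFinM divff// mule1.
  by [].
have qE z A : q z A = obs_law P z (fst @^-1` A) by [].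
have mfst (A : set R) : measurable A -> measurable (fst @^-1` A : set (R * bool)).
  exact: measurable_preim measurable_fst.
have [p [p_gt0 _ pE]] := Z_masses P_Z.
have iZ z : (given_Z P z).-integrable setT (EFin \o @obsY R).
  apply: integrable_of_le_measure (p_gt0 z) _ P_Y => A mA.
  rewrite -[X in (_ * X <= _)%E]/(given_Z P z A) /given_Z.
  have pz_neq0 := lt0r_neq0 (p_gt0 z).
  rewrite (cond_probE _ (pE z) pz_neq0) muleCA -EFinM divff// mule1.
  rewrite le_measure ?inE//; apply: measurableI => //.
  exact: measurable_obsZ_eq.
have mE : measurable_fun setT (EFin \o @id R) by exact: EFin_measurable.
have iq z : (q z).-integrable setT (EFin \o id).
  by have [_] := integrable_distribution (given_Z P z) (@obsY R) mE; apply.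
have qk A : measurable A ->
    (q true A + c%:E * k false A = q false A + c%:E * k true A)%E.
  by move=> mA; rewrite !ckE !qE obs_law_balance//; exact: mfst.
have kq t A : measurable A -> (c%:E * k t A <= q t A)%E.
  by move=> mA; rewrite ckE qE complier_part_le//; exact: mfst.
have [ik dE] := balanced_means (@measurable_id _ _ setT) c_gt0 qk kq iq.
pose e t := fine (\int[k t]_y y%:E).
exists (e true - e false).
  have kmu t : k t `<< mu.
    apply/null_content_dominatesP => A mA muA0.
    have muA := (null_content_dominatesP _ _).1 (Ps_dom t) A mA muA0.
    have CA : C (dgpY t @^-1` A) = 0%E.
      have mYA := measurable_preim (@measurable_dgpY R t) mA.
      have YA0 : Ps (dgpY t @^-1` A) = 0%E := muA.
      rewrite /C CE (subset_measure0 _ _ _ YA0) ?mul0e//.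
      by apply: measurableI => //; exact: measurable_compliers.
    exact: CA.
  have [f1 [f1P f1E]] := density_of_dominated (kmu true) (ik true).
  have [f0 [f0P f0E]] := density_of_dominated (kmu false) (ik false).
  by exists f0, f1; split=> //; rewrite f1E f0E.
split.
  rewrite -dE /DeltaE unlock; congr (fine _ - fine _);
    by rewrite integral_distribution.
have iC t : C.-integrable setT (EFin \o dgpY t).
  by have [+ _] := integrable_distribution C (Y t) mE; apply; exact: ik.
have EC : 'E_C[fun w => (dgpY true w - dgpY false w)%R]%E = (e true - e false)%:E.
  have ekE t : (\int[C]_w (dgpY t w)%:E = (e t)%:E)%E.
    rewrite /e fineK; last exact: integrable_fin_num (ik t).
    exact/esym/(integral_distribution (X := Y t) mE (iC t)).
  rewrite unlock EFinB -!ekE.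
  exact: integralB_EFin measurableT (iC true) (iC false).
move=> theta'; rewrite /LATE cE eqe (negbTE c_neq0) EC.
by split=> [[]|->].
Qed.
End LATE.

(** * Existence: a process with a prescribed mass of compliers *)

Lemma measurable_observe (R : realType) : measurable_fun setT (@observe R).
Proof.
have mt : measurable_fun setT (@true_treatment R).
  rewrite (_ : @true_treatment R = fun w =>
    if dgpZ w then dgpTstar true w else dgpTstar false w).
    apply: measurable_fun_ifT; [exact: measurable_dgpZ|exact: measurable_dgpTstar..].
  by apply/funext => w; rewrite /true_treatment; case: dgpZ.
have mYT : measurable_fun setT (fun w : dgp R => dgpYT (true_treatment w) w).
  rewrite (_ : (fun w => _) = fun w : dgp R =>
    if true_treatment w then dgpYT true w else dgpYT false w).
    apply: measurable_fun_ifT; [exact: mt|exact: measurable_dgpYT..].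
  by apply/funext => w; case: true_treatment.
exact: measurable_fun_pair mYT (@measurable_dgpZ R).
Qed.

Lemma measurable_slice d (T : measurableType d) (A : set (T * bool)) (z : bool) :
  measurable A -> measurable [set v | A (v, z)].
Proof.
by move=> mA; apply: (measurable_preim _ mA); exact: measurable_fun_pair.
Qed.

Section IndependentInstrument.
Context (R : realType).

Local Notation types R := ((R * R) * (bool * bool) * (bool * bool))%type.

Context (L : probability (types R) R) (p : bool -> R).
Hypotheses (p_gt0 : forall z, 0 < p z) (p1 : p true + p false = 1).

(** The product of the law [L] of the types and the law [p] of the instrument,
    in the form of a sum of slices, which is the form used for computing. *)
Lemma exists_dgp_indep : exists Ps : probability (dgp R) R,
  forall A, measurable A ->
    (Ps A = (p true)%:E * L [set v | A (v, true)] +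
            (p false)%:E * L [set v | A (v, false)])%E.
Proof.
have mz (z : bool) : measurable_fun setT (fun v : types R => (v, z)).
  exact: measurable_fun_pair.
have [P1 P1E] := exists_pushforward L (mz true).
have [P0 P0E] := exists_pushforward L (mz false).
have pf : p false = 1 - p true by rewrite -p1 addrC addKr.
have p01 : 0 <= p true <= 1 by rewrite ltW//= -subr_ge0 -pf ltW.
have [Ps PsE] := exists_mixture P1 P0 p01.
by exists Ps => A mA; rewrite PsE// P1E P0E pf.
Qed.

Context (Ps : probability (dgp R) R).
Hypothesis PsE : forall A, measurable A ->
  (Ps A = (p true)%:E * L [set v | A (v, true)] +
          (p false)%:E * L [set v | A (v, false)])%E.

Lemma types_event_law (A : set (dgp R)) : measurable A ->
  (forall v, A (v, true) <-> A (v, false)) -> Ps A = L [set v | A (v, true)].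
Proof.
move=> mA Az; rewrite PsE// (_ : [set v | A (v, false)] = [set v | A (v, true)]).
  have [x _ xE] := probability_EFin L (measurable_slice true mA).
  by rewrite xE -!EFinM -EFinD -mulrDl p1 mul1r.
by apply/seteqP; split=> v /Az.
Qed.

Lemma types_event_indep (A : set bool) (G : set (dgp R)) :
  measurable A -> measurable G -> (forall v, G (v, true) <-> G (v, false)) ->
  Ps (@dgpZ R @^-1` A `&` G) = (Ps (@dgpZ R @^-1` A) * Ps G)%E.
Proof.
pose q z := if `[< A z >] then p z else 0.
have step (F : set (dgp R)) : measurable A -> measurable F ->
    (forall v, F (v, true) <-> F (v, false)) ->
    Ps (@dgpZ R @^-1` A `&` F) = ((q true + q false)%:E * Ps F)%E.
  move=> mA mF Fz; have mZA := measurable_preim (@measurable_dgpZ R) mA.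
  rewrite PsE; last exact: measurableI.
  rewrite (types_event_law mF Fz).
  have [x _ xE] := probability_EFin L (measurable_slice true mF).
  have slice z : ((p z)%:E * L [set v | (@dgpZ R @^-1` A `&` F) (v, z)] =
      (q z)%:E * L [set v | F (v, true)])%E.
    rewrite /q; case: asboolP => Az.
      congr (_ * L _)%E; apply/seteqP; split=> v /=.
        by move=> [_]; case: (z) => // /Fz.
      by move=> Fv; split=> //; case: (z) => //; apply/Fz.
    rewrite mul0e (_ : [set v | _] = set0) ?measure0 ?mule0//.
    by apply/seteqP; split=> v // [].
  by rewrite !slice xE -!EFinM -EFinD mulrDl.
(* The case [F = setT] says that [q true + q false] is the probability of [A] *)
move=> mA mG Gz; rewrite step// -[@dgpZ R @^-1` A]setIT step//.
by rewrite probability_setT mule1.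
Qed.

Lemma instrument_law (z : bool) : Ps [set w | dgpZ w = z] = (p z)%:E.
Proof.
have mZ : measurable [set w : dgp R | dgpZ w = z].
  exact: (measurable_preim (@measurable_dgpZ R) (A := [set z])).
have full : [set v : types R | z = z] = setT by apply/seteqP; split.
have empty : [set v : types R | ~~ z = z] = set0.
  by apply/seteqP; split=> // v; rewrite /=; case: z mZ full.
rewrite PsE//; case: z full empty {mZ} => full empty;
  by rewrite /dgpZ/= full empty probability_setT measure0 mule1 mule0 ?adde0 ?add0e.
Qed.

End IndependentInstrument.

Section Construction.
Context (R : realType).

Local Notation types R := ((R * R) * (bool * bool) * (bool * bool))%type.

(** A complier draws the pair (outcome, measured treatment) under treatment and
    the one without treatment separately; the first component of [x] is the
    treated pair. *)
Definition complier_types (x : (R * bool) * (R * bool)) : types R :=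
  ((x.2.1, x.1.1), (x.2.2, x.1.2), (false, true)).

(** The treated pair of someone who is never treated is never observed; copying
    the untreated pair keeps its outcome dominated by [mu]. *)
Definition nevertaker_types (x : R * bool) : types R :=
  ((x.1, x.1), (x.2, x.2), (false, false)).

Lemma measurable_complier_types : measurable_fun setT complier_types.
Proof.
pose X := ((R * bool) * (R * bool))%type.
have m1 (i : bool) : measurable_fun setT (fun x : X => if i then x.1 else x.2).
  by case: i; [exact: measurable_fst|exact: measurable_snd].
have m11 (i : bool) : measurable_fun setT
    (fun x : X => (if i then x.1 else x.2).1).
  exact: measurableT_comp measurable_fst (m1 i).
have m12 (i : bool) : measurable_fun setT
    (fun x : X => (if i then x.1 else x.2).2).
  exact: measurableT_comp measurable_snd (m1 i).
apply: measurable_fun_pair; last exact: measurable_cst.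
apply: measurable_fun_pair; apply: measurable_fun_pair.
- exact: m11 false.
- exact: m11 true.
- exact: m12 false.
- exact: m12 true.
Qed.

Lemma measurable_nevertaker_types : measurable_fun setT nevertaker_types.
Proof.
apply: measurable_fun_pair; last exact: measurable_cst.
by apply: measurable_fun_pair; apply: measurable_fun_pair;
  (exact: measurable_fst || exact: measurable_snd).
Qed.

Context (mu : {finite_measure set R -> \bar R}) (P : probability (obs R) R)
  (B : bool -> probability (R * bool)%type R)
  (N : probability (R * bool)%type R) (c : R).
Hypotheses (P_Z : (0 < P [set w | obsZ w = true] < 1)%E)
  (P_dom : pushforward P (@obsY R) `<< mu) (c01 : 0 <= c <= 1)
  (BN : forall z A, measurable A ->
    (obs_law P z A = c%:E * B z A + (1 - c)%:E * N A)%E).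

Lemma exists_types_law : exists L : probability (types R) R,
  forall A, measurable A ->
    (L A = c%:E * (B true \x B false) (complier_types @^-1` A) +
           (1 - c)%:E * N (nevertaker_types @^-1` A))%E.
Proof.
have [Lc LcE] := exists_pushforward (B true \x B false)%E measurable_complier_types.
have [Ln LnE] := exists_pushforward N measurable_nevertaker_types.
have [L LE] := exists_mixture Lc Ln c01.
by exists L => A mA; rewrite LE// LcE LnE.
Qed.

(** The one computation behind both the domination of the outcomes and the law
    of the observables: an event that looks only at the treatment [t] pair of
    the compliers, and at the only pair of the others, has the probability that
    the decomposition [BN] reassembles into the law given [Z = t]. *)
Lemma types_law_marginal (L : probability (types R) R) (t : bool)
    (A : set (R * bool)) (E : set (types R)) :
  (L E = c%:E * (B true \x B false) (complier_types @^-1` E) +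
         (1 - c)%:E * N (nevertaker_types @^-1` E))%E ->
  measurable A ->
  complier_types @^-1` E = [set x | A (if t then x.1 else x.2)] ->
  nevertaker_types @^-1` E = A -> L E = obs_law P t A.
Proof.
move=> LE mA cE nE; rewrite LE cE nE BN//; congr (_ * _ + _)%E.
case: t {cE} => /=.
- rewrite (_ : [set _ | _] = A `*` setT); last by apply/seteqP; split=> -[? ?] // [].
  by rewrite [LHS]product_measure1E// [X in (_ * X)%E]probability_setT mule1.
- rewrite (_ : [set _ | _] = setT `*` A); last by apply/seteqP; split=> -[? ?] // [].
  by rewrite [LHS]product_measure1E// [X in (X * _)%E]probability_setT mul1e.
Qed.

(** Compliers reveal [B true] or [B false] according to the instrument and the
    never-takers reveal [N] in both cases, so the observed laws given [Z] are
    the mixtures of [BN]. *)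
Lemma exists_dgp_with_complier_mass : exists Ps : probability (dgp R) R,
  [/\ admissible mu Ps, induces Ps P & Ps (@compliers R) = c%:E].
Proof.
have [p [p_gt0 p1 pE]] := Z_masses P_Z.
have [L LE] := exists_types_law.
have [Ps PsE] := exists_dgp_indep L p_gt0 p1.
have PsL := types_event_law p1 PsE.
exists Ps; split; first split.
- move=> t; apply/null_content_dominatesP => A mA muA.
  have YA0 : P (@obsY R @^-1` A) = 0%E.
    by have /null_content_dominatesP := P_dom; apply.
  have mYA : measurable (@dgpY R t @^-1` A).
    exact: measurable_preim (@measurable_dgpY R t) mA.
  have mfA : measurable (fst @^-1` A : set (R * bool)).
    exact: measurable_preim measurable_fst mA.
  have -> : pushforward Ps (dgpY t) A = obs_law P t (fst @^-1` A).
    rewrite /pushforward (PsL _ mYA); last by move=> v; case: (t); split.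
    apply: (types_law_marginal (LE _ (measurable_slice true mYA)) mfA);
      by case: (t).
  have ZE := obs_lawE (pE t) (lt0r_neq0 (p_gt0 t)) (fst @^-1` A).
  have [x _ xE] := probability_EFin (obs_law P t) mfA.
  move: ZE; rewrite (subset_measure0 _ _ _ YA0).
  + by rewrite xE -EFinM => -[] /eqP; rewrite mulf_eq0 gt_eqF// => /eqP ->.
  + apply: measurableI; last exact: measurable_obsZ_eq.
    exact: measurable_preim (@measurable_obsYT R) mfA.
  + exact: measurable_preim (@measurable_obsY R) mA.
  + by move=> w [].
- split.
  + move=> t A B' mA mB.
    have mW : measurable_fun setT (fun w : dgp R =>
        (dgpT t w, dgpY t w, dgpTstar false w, dgpTstar true w)).
      apply: measurable_fun_pair; last exact: measurable_dgpTstar.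
      apply: measurable_fun_pair; last exact: measurable_dgpTstar.
      exact: measurable_fun_pair (@measurable_dgpT R t) (@measurable_dgpY R t).
    by apply: (types_event_indep p1 PsE mA (measurable_preim mW mB)); case: (t).
  + have mT z b : measurable (@dgpTstar R z @^-1` [set b]).
      exact: measurable_preim (@measurable_dgpTstar R z) _.
    pose D : set (dgp R) :=
      dgpTstar false @^-1` [set true] `&` dgpTstar true @^-1` [set false].
    have mD : measurable D by exact: measurableI.
    exists D; split=> //; last first.
      by move=> w /= /negP; rewrite /D/=; case: w.1.2 => -[] [].
    rewrite PsL//.
    have cE : complier_types @^-1` [set v | D (v, true)] = set0.
      by apply/seteqP; split=> // x [].
    have nE : nevertaker_types @^-1` [set v | D (v, true)] = set0.
      by apply/seteqP; split=> // x [].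
    by rewrite (LE _ (measurable_slice true mD)) cE nE !measure0 !mule0 adde0.
  + by rewrite (instrument_law PsE) !lte_fin p_gt0/= -p1 ltrDl p_gt0.
- move=> A mA.
  have mAz z := measurable_slice z mA.
  have mO := measurable_preim (@measurable_observe R) mA.
  have observe_slice z :
      L [set v | A (observe (v, z))] = obs_law P z [set x | A (x, z)].
    apply: (types_law_marginal (LE _ (measurable_slice z mO)) (mAz z)); case: (z).
    + by apply/seteqP; split=> -[[? ?] ?].
    + by apply/seteqP; split=> -[? [? ?]].
    + by apply/seteqP; split=> -[? ?].
    + by apply/seteqP; split=> -[? ?].
  have sliceE z : ((p z)%:E * L [set v | (@observe R @^-1` A) (v, z)] =
      P (A `&` [set w | obsZ w = z]))%E.
    rewrite observe_slice (obs_lawE (pE z) (lt0r_neq0 (p_gt0 z))); congr (P _).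
    by apply/seteqP; split=> -[x z'] /= [+ zz']; rewrite /obsZ/= in zz'; rewrite zz'.
  rewrite /pushforward PsE// !sliceE.
  have mZ := @measurable_obsZ_eq R.
  have <- U V : measurable U -> measurable V -> U `&` V = set0 ->
      P (U `|` V) = (P U + P V)%E by exact: measureU.
  + congr (P _); rewrite -setIUr -[RHS]setIT; congr (_ `&` _).
    by apply/seteqP; split=> // w _; case E : (obsZ w); [left|right].
  + exact: measurableI.
  + exact: measurableI.
  + by apply/seteqP; split=> // w /= [[_ ->] []].
- rewrite PsL; [|exact: measurable_compliers|by []].
  have mE := measurable_slice true (@measurable_compliers R).
  have cE : complier_types @^-1` [set v | @compliers R (v, true)] = setT.
    by apply/seteqP; split.
  have nE : nevertaker_types @^-1` [set v | @compliers R (v, true)] = set0.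
    by apply/seteqP; split.
  rewrite (LE _ mE) cE nE measure0 mule0 adde0.
  by rewrite [X in (_ * X)%E]probability_setT mule1.
Qed.

End Construction.

(** * The identified set *)

Section TotalVariation.
Context (R : realType) (mu : {finite_measure set R -> \bar R})
  (P : probability (obs R) R).
Hypotheses (P_Z : (0 < P [set w | obsZ w = true] < 1)%E)
  (P_dom : pushforward P (@obsY R) `<< mu).

(** A null set of the product with counting measure has two null slices. *)
Lemma obs_law_dominated (z : bool) : obs_law P z `<< muYT mu.
Proof.
apply/null_content_dominatesP => A mA muA.
pose S (t : bool) : set R := [set y | A (y, t)].
have mS t : measurable (S t).
  by apply: (measurable_preim _ mA); exact: measurable_fun_pair.
have muS t : mu (S t) = 0%E.
  have mt : measurable [set t] by [].
  have /eqP : muYT mu (S t `*` [set t]) = 0%E.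
    apply: subset_measure0 muA => //; first exact: measurableX.
    by move=> [y t'] /= [Ay ->].
  rewrite [muYT _ _]product_measure1E// mule_eq0 => /orP[/eqP//|].
  have one : counting_bool R [set t] = 1%:E.
    by rewrite /counting_bool /counting asboolT// fset_set1 finmap.cardfs1.
  by move=> /eqP/(etrans (esym one)) [] /eqP; rewrite oner_eq0.
have PS t : P (@obsY R @^-1` S t) = 0%E.
  by have /null_content_dominatesP dom := P_dom; exact: dom _ (mS t) (muS t).
have mYS t : measurable (@obsY R @^-1` S t).
  exact: measurable_preim (@measurable_obsY R) (mS t).
have PA : P (@obsYT R @^-1` A `&` [set w | obsZ w = z]) = 0%E.
  have PU : P (@obsY R @^-1` S true `|` @obsY R @^-1` S false) = 0%E.
    by apply: (etrans (measureU0 (mYS true) (mYS false) (PS false))) (PS true).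
  apply: subset_measure0 PU; last 2 first.
  - exact: measurableU.
  - by move=> [[y t] z'] /= [Ay _]; case: t Ay => ?; [left|right].
  apply: measurableI; last exact: measurable_obsZ_eq.
  exact: measurable_preim (@measurable_obsYT R) mA.
have [p [p_gt0 _ pE]] := Z_masses P_Z.
have := obs_lawE (pE z) (lt0r_neq0 (p_gt0 z)) A.
have [x _ xE] := probability_EFin (obs_law P z) mA.
by rewrite PA xE -EFinM => -[] /eqP; rewrite mulf_eq0 gt_eqF// => /eqP ->.
Qed.

Lemma TV_YT_Hahn : exists H : set (R * bool),
  [/\ measurable H,
    forall A, measurable A -> A `<=` H ->
      (obs_law P false A <= obs_law P true A)%E,
    forall A, measurable A -> A `<=` ~` H ->
      (obs_law P true A <= obs_law P false A)%E &
    TV_YT mu P = fine (obs_law P true H) - fine (obs_law P false H)].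
Proof. exact: Radon_Nikodym_Hahn (obs_law_dominated _) (obs_law_dominated _). Qed.

End TotalVariation.

Lemma quotients_by_masses (R : realType) (D tv theta : R) : 0 < tv <= 1 ->
  (exists2 c, tv <= c <= 1 & D = c * theta) <->
  (if 0 < D then `[D, D / tv]%classic
   else if D == 0 then [set 0] else `[D / tv, D]%classic) theta.
Proof.
move=> /andP[tv_gt0 tv1]; split=> [[c /andP[tvc c1] ->]|].
  have c_gt0 := lt_le_trans tv_gt0 tvc.
  rewrite pmulr_rgt0// mulf_eq0 (gt_eqF c_gt0)/=.
  have [theta_lt0|theta_gt0|->//] := ltgtP theta 0; rewrite /= in_itv/=.
  - by rewrite ler_pdivrMr// ; nra.
  - by rewrite ler_pdivlMr// ; nra.
have [D_lt0|D_gt0|->] := ltgtP D 0; rewrite /= ?in_itv/=.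
- rewrite ler_pdivrMr// => /andP[h1 h2]; have theta_lt0 := le_lt_trans h2 D_lt0.
  exists (D / theta); last by rewrite divfK ?lt_eqF.
  by rewrite ler_ndivlMr// ler_ndivrMr// mul1r h2 mulrC h1.
- rewrite ler_pdivlMr// => /andP[h1 h2]; have theta_gt0 := lt_le_trans D_gt0 h1.
  exists (D / theta); last by rewrite divfK ?gt_eqF.
  by rewrite ler_pdivlMr// ler_pdivrMr// mul1r h1 mulrC h2.
- by move=> ->; exists 1; rewrite ?mulr0// tv1 lexx.
Qed.

Theorem theorem4 (R : realType) (mu : {finite_measure set R -> \bar R})
    (P : probability (obs R) R)
    (P_Z : (0 < P [set w | obsZ w = true] < 1)%E)
    (P_Y : P.-integrable setT (fun w => (obsY w)%:E))
    (P_dom : pushforward P (@obsY R) `<< mu) :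
  identified_set mu P =
    let D := DeltaE P (@obsY R) in
    let tv := TV_YT mu P in
    if tv == 0 then Theta mu
    else if 0 < D then `[D, D / tv]%classic
    else if D == 0 then [set 0]
    else `[D / tv, D]%classic.
Proof.
cbv zeta; set tv := TV_YT mu P.
have [H [mH posH negH tvE]] := TV_YT_Hahn P_Z P_dom.
have [q1 _ q1E] := probability_EFin (obs_law P true) mH.
have [q0 q0_ge0 q0E] := probability_EFin (obs_law P false) mH.
have tvq : tv = q1 - q0 by rewrite /tv tvE q1E q0E.
have tv_ge0 : 0 <= tv by rewrite tvq subr_ge0 -lee_fin -q1E -q0E; exact: posH.
have tv_le1 : tv <= 1.
  have : (q1%:E <= 1)%E by rewrite -q1E probability_le1.
  by rewrite lee_fin tvq; lra.
(* The mass [c = 0] is included; it occurs only when [tv = 0]. *)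
have exists_dgp (c : R) : tv <= c <= 1 -> exists Ps : probability (dgp R) R,
    [/\ admissible mu Ps, induces Ps P & Ps (@compliers R) = c%:E].
  move=> /andP[tvc c1].
  have [|B [N BN]] := overlap_split (c := c) mH posH negH.
    by rewrite -tvE tvc c1.
  by apply: exists_dgp_with_complier_mass BN => //; rewrite (le_trans tv_ge0 tvc).
have [tv0|tv_neq0] := eqVneq tv 0.
  apply/seteqP; split=> [theta []//|theta Theta_theta].
  have [|Ps [PsA PsP Ps0]] := exists_dgp 0; first by rewrite tv0 lexx ler01.
  by split=> //; exists Ps; split=> //; rewrite /LATE Ps0 eqxx.
have tv_gt0 : 0 < tv by rewrite lt0r tv_neq0.
have interval := quotients_by_masses (DeltaE P (@obsY R)) _
  (introT andP (conj tv_gt0 tv_le1)).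
apply/seteqP; split=> theta; last first.
  move=> /interval[c c_itv DE].
  have [Ps [PsA PsP PsC]] := exists_dgp c c_itv.
  have c_neq0 : c != 0.
    by case/andP: c_itv => /(lt_le_trans tv_gt0) /lt0r_neq0.
  have [theta' theta'T [DE' LATE_theta']] :=
    LATE_of_compliers P_Z P_Y PsA PsP PsC c_neq0.
  have -> : theta = theta' by apply: (mulfI c_neq0); rewrite -DE -DE'.
  by split=> //; exists Ps; split=> //; apply/LATE_theta'.
move=> [_ [Ps [PsA PsP PsL]]]; apply/interval.
have [c c_ge0 PsC] := probability_EFin Ps (@measurable_compliers R).
have tvc : tv <= c.
  rewrite -lee_fin -PsC tvq EFinB -q1E -q0E.
  exact: (complier_mass_ge P_Z PsA PsP mH).
have c_neq0 : c != 0 by rewrite gt_eqF// (lt_le_trans tv_gt0).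
have [theta' _ [DE LATE_theta']] := LATE_of_compliers P_Z P_Y PsA PsP PsC c_neq0.
exists c; last by rewrite DE; congr (_ * _); apply/esym/LATE_theta'.
rewrite tvc -lee_fin -PsC.
exact: (probability_le1 Ps (@measurable_compliers R)).
Qed.
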